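(* Let $\psi: T \to \mathbb{C}$ be a function and $\varphi: T \to T$ a self-map for which $W_{\psi,\varphi}$ is bounded on $L_\mu^\infty$. Then $W_{\psi,\varphi}$ has a bounded inverse (on $L_\mu^\infty$) if and only if $\varphi$ is bijective and $$\inf_{v\in T} \frac{\mu(v)}{\mu(\varphi(v))}|\psi(v)| > 0.$$ In this case, $W_{\psi,\varphi}^{-1} = W_{1/(\psi\circ\varphi^{-1}),\,\varphi^{-1}}$ and $$\|W_{\psi,\varphi}^{-1}\| = \sup_{v\in T} \frac{\mu(v)}{\mu(\varphi^{-1}(v))}\left|\frac{1}{\psi(\varphi^{-1}(v))}\right| = \sup_{v\in T} \frac{\mu(\varphi(v))}{\mu(v)}\left|\frac{1}{\psi(v)}\right|.$$
   Context: $(T,\mathrm{d})$ is a metric space with a distinguished point $o$ (the root); the length of $v \in T$ is $|v| = \mathrm{d}(o,v)$. $T$ is assumed locally finite (for every $M>0$ the set $\{v \in T : |v| < M\}$ is finite) and unbounded (for every $M>0$ there is $v \in T$ with $|v| \ge M$). $\mu: T \to (0,\infty)$ is an arbitrary positive function (a weight). $L_\mu^\infty$ is the Banach space of functions $f: T \to \mathbb{C}$ with $\|f\|_\mu = \sup_{v \in T} \mu(v)|f(v)| < \infty$. For a function $\psi$ on $T$ and a self-map $\varphi$ of $T$, the weighted composition operator is the linear map $W_{\psi,\varphi} f = \psi\,(f\circ\varphi)$; it is bounded on $L_\mu^\infty$ if it is a bounded operator from $L_\mu^\infty$ to itself. *)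

(* Defs.v *)
From HB Require Import structures.
From mathcomp Require Import all_boot all_order all_algebra.
From mathcomp Require Import all_classical all_reals all_analysis.
From mathcomp Require Export complex.

Set Implicit Arguments.
Unset Strict Implicit.
Unset Printing Implicit Defensive.

Import Order.TTheory GRing.Theory Num.Theory.
Import numFieldNormedType.Exports.
Export Normc.

Local Open Scope classical_set_scope.
Local Open Scope ring_scope.
Local Open Scope complex_scope.

Definition wbounded (R : realType) (T : Type) (mu : T -> {posnum R}) :
    {pred T -> R[i]^o} :=
  [pred f | `[< has_ubound (range (fun v => (mu v)%:num * normc (f v))) >]].

(* The space L_mu^oo.  Positivity of the weight is part of the type of [mu],
   so that the weighted sup norm below is a norm. *)
Record wLinf (R : realType) (T : Type) (mu : T -> {posnum R}) := WLinf {
  wLinf_fun :> T -> R[i]^o ;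
  wLinf_bounded : wLinf_fun \in wbounded mu }.

(* This is the supremum in R; the set is bounded above for [f : wLinf mu]. *)
Definition wnorm (R : realType) (T : Type) (mu : T -> {posnum R})
    (f : T -> R[i]) : R :=
  sup (range (fun v => (mu v)%:num * normc (f v))).

Section wLinf_normedModType.
Context (R : realType) (T : Type) (mu : T -> {posnum R}).

HB.instance Definition _ := [isSub for @wLinf_fun R T mu].
HB.instance Definition _ := [Choice of wLinf mu by <:].

Let normcD (x y : R[i]) : normc (x + y) <= normc x + normc y.
Proof. by rewrite -lecR rmorphD; exact: (ler_normD x y). Qed.

Let normc_ge0 (x : R[i]) : 0 <= normc x.
Proof. by rewrite -lecR; exact: (normr_ge0 x). Qed.

Let wboundedP (f : T -> R[i]^o) : reflect
  (exists M, forall v, (mu v)%:num * normc (f v) <= M) (f \in wbounded mu).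
Proof.
apply: (iffP idP); rewrite inE/=.
  by move=> [M fM]; exists M => v; apply: fM; exists v.
by move=> [M fM]; exists M => _ [v _ <-].
Qed.

Let wbounded_submod : submod_closed (wbounded mu).
Proof.
split.
  by apply/wboundedP; exists 0 => v; rewrite [normc _]normc0 mulr0.
move=> a f g /wboundedP[M fM] /wboundedP[N gN].
apply/wboundedP; exists (normc a * M + N) => v.
apply: (@le_trans _ _ ((mu v)%:num * (normc (a * f v) + normc (g v)))).
  by rewrite ler_wpM2l// normcD.
by rewrite mulrDr lerD// normcM mulrCA ler_wpM2l.
Qed.

HB.instance Definition _ :=
  GRing.isSubmodClosed.Build _ _ (wbounded mu) wbounded_submod.
HB.instance Definition _ := [SubChoice_isSubLmodule of wLinf mu by <:].

Lemma le_wnorm (f : wLinf mu) v : (mu v)%:num * normc (f v) <= wnorm mu f.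
Proof.
apply: ub_le_sup; last by exists v.
by move: (wLinf_bounded f); rewrite inE.
Qed.

Lemma wnorm_le (f : T -> R[i]) M : 0 <= M ->
  (forall v, (mu v)%:num * normc (f v) <= M) -> wnorm mu f <= M.
Proof.
move=> M0 fM; have [E0|/set0P E0] := eqVneq
    (range (fun v => (mu v)%:num * normc (f v))) set0.
  by rewrite /wnorm E0 sup0.
by apply: ge_sup => // _ [v _ <-].
Qed.

Let wnorm_ge0 (f : wLinf mu) : 0 <= wnorm mu f.
Proof.
have [E0|/set0P[_ [v _ _]]] := eqVneq
    (range (fun v => (mu v)%:num * normc (f v))) set0.
  by rewrite /wnorm E0 sup0.
by apply: le_trans (le_wnorm f v); rewrite mulr_ge0.
Qed.

Let wnormD (f g : wLinf mu) :
  (wnorm mu (f + g : wLinf mu))%:C <= (wnorm mu f)%:C + (wnorm mu g)%:C.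
Proof.
rewrite -rmorphD lecR wnorm_le ?addr_ge0// => v.
apply: (@le_trans _ _ ((mu v)%:num * (normc (f v) + normc (g v)))).
  by rewrite ler_wpM2l// normcD.
by rewrite mulrDr lerD// le_wnorm.
Qed.

Let wnormZ_le (l : R[i]) (f : wLinf mu) :
  wnorm mu (l *: f : wLinf mu) <= normc l * wnorm mu f.
Proof.
rewrite wnorm_le ?mulr_ge0// => v.
by rewrite [normc _]normcM mulrCA ler_wpM2l// le_wnorm.
Qed.

Let wnormZ (l : R[i]) (f : wLinf mu) :
  (wnorm mu (l *: f : wLinf mu))%:C = `|l| * (wnorm mu f)%:C.
Proof.
rewrite -[`|l|]/((normc l)%:C) -rmorphM; congr (_%:C).
apply/le_anti; rewrite wnormZ_le andTb.
have [->|l0] := eqVneq l 0; first by rewrite normc0 mul0r wnorm_ge0.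
have nl0 : 0 < normc l.
  rewrite lt_def normc_ge0 andbT; apply/eqP => /(@eq0_normc R) l_eq0.
  by rewrite l_eq0 eqxx in l0.
rewrite -ler_pdivlMl// -normcV.
by apply: le_trans (wnormZ_le _ _); rewrite scalerA mulVf// scale1r.
Qed.

Let wnorm0_eq0 (f : wLinf mu) : (wnorm mu f)%:C = 0 -> f = 0.
Proof.
move=> [f0]; apply/val_inj/funext => v /=; apply: eq0_normc.
apply/le_anti; rewrite normc_ge0 andbT.
by rewrite -(pmulr_rle0 _ (gt0 (mu v))) -f0 le_wnorm.
Qed.

HB.instance Definition _ :=
  Lmodule_isNormed.Build R[i] (wLinf mu) wnormD wnormZ wnorm0_eq0.

(* The norm of a normed space over R[i] takes its values in R[i]. *)
Lemma wLinf_normE (f : wLinf mu) : `|f| = (wnorm mu f)%:C.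
Proof. by []. Qed.

End wLinf_normedModType.

Definition wcomp (R : realType) (T : Type) (psi : T -> R[i]) (phi : T -> T)
    (f : T -> R[i]) : T -> R[i] :=
  fun v => psi v * f (phi v).

Definition bounded_operator (R : realType) (V : normedModType R[i])
    (A : {linear V -> V}) : Prop :=
  exists M : R, forall f : V, `|A f| <= M%:C * `|f|.

Definition bounded_inverse (R : realType) (V : normedModType R[i])
    (A B : {linear V -> V}) : Prop :=
  [/\ bounded_operator B, cancel A B & cancel B A].

(* [complex.Re] only casts the real number `|A f| : R[i] to R. *)
Definition opnorm (R : realType) (V : normedModType R[i])
    (A : {linear V -> V}) : \bar R :=
  ereal_sup [set (complex.Re `|A f|)%:E | f in [set f : V | `|f| <= 1]].

(* Main.v *)
(* Everything is tested on the functions [wdelta w], the indicators of single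
   points: [W (wdelta w)] is supported on the fibre of [phi] over [w].
   If [W] is invertible then [psi v * S f (phi v) = f v] for all [f] and [v];
   indicators then show that [psi] has no zero and that [phi] is injective,
   the kernel of [W] that [phi] is surjective, and the bound of [S] at
   [wdelta v] that the infimum is positive.  Conversely the infimum bounds the
   weighted composition operator of the inverse symbols.  The norm formula holds
   for every weighted composition operator, normalized indicators attaining
   each term of the supremum. *)
From HB Require Import structures.
Require Import Defs.
From mathcomp Require Import all_boot all_order all_algebra.
From mathcomp Require Import all_classical all_reals all_analysis.

Import Order.TTheory GRing.Theory Num.Theory.
Import numFieldNormedType.Exports.

Local Open Scope classical_set_scope.
Local Open Scope ring_scope.
Local Open Scope complex_scope.

Lemma normc_ge0 (R : realType) (x : R[i]) : 0 <= normc x.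
Proof. by rewrite -lecR; exact: (normr_ge0 x). Qed.

Section wLinf_operators.
Context {R : realType} {T : eqType} {mu : T -> {posnum R}}.
Implicit Types (f g : wLinf mu) (psi : T -> R[i]) (phi : T -> T) (v w : T).

Lemma wLinf_ext f g : (f : T -> R[i]) =1 g -> f = g.
Proof. by move=> fg; apply/val_inj/funext. Qed.

Lemma wLinf_scaleE (a : R[i]) f v : (a *: f) v = a * f v.
Proof. by []. Qed.

Lemma wnorm_ge0 f : 0 <= wnorm mu f.
Proof. by rewrite -lecR -wLinf_normE; exact: (normr_ge0 f). Qed.

Lemma mem_wbounded (f : T -> R[i]) (M : R) :
  (forall v, (mu v)%:num * normc (f v) <= M) -> f \in wbounded mu.
Proof. by move=> fM; rewrite inE/=; exists M => _ [v _ <-]. Qed.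

Lemma wdelta_le w v :
  (mu v)%:num * normc ((v == w)%:R : R[i]) <= (mu w)%:num.
Proof.
have [->|_] := eqVneq v w; first by rewrite [normc _]normc1 mulr1.
by rewrite [normc _]normc0 mulr0.
Qed.

Definition wdelta w : wLinf mu :=
  WLinf (mem_wbounded (fun v => (v == w)%:R) (mu w)%:num (wdelta_le w)).

Lemma wdelta_neq0 w : wdelta w <> 0.
Proof.
move=> /(congr1 (fun f : wLinf mu => f w)) /=.
by rewrite eqxx; apply/eqP; exact: oner_neq0.
Qed.

Lemma wnorm_wdelta w : wnorm mu (wdelta w) = (mu w)%:num.
Proof.
apply/le_anti; rewrite wnorm_le//=; last exact: wdelta_le.
apply: le_trans (le_wnorm (wdelta w) w).
by rewrite /= eqxx [normc _]normc1 mulr1.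
Qed.

(** The weighted value at [v] factors as the ratio at [v] times [mu * |f|] at [phi v], and the
    latter is at most the norm of [f]. *)
Lemma wcomp_le psi phi (M : R) f v :
  (mu v)%:num / (mu (phi v))%:num * normc (psi v) <= M ->
  (mu v)%:num * normc (wcomp psi phi f v) <= M * wnorm mu f.
Proof.
move=> psiM; rewrite /wcomp normcM.
rewrite (_ : _ * _ = (mu v)%:num / (mu (phi v))%:num * normc (psi v) *
  ((mu (phi v))%:num * normc (f (phi v)))).
  by rewrite ler_pM ?le_wnorm// ?mulr_ge0 ?normc_ge0.
by rewrite mulrACA divfK.
Qed.

Lemma bounded_wcomp psi phi (M : R) : 0 <= M ->
  (forall v, (mu v)%:num / (mu (phi v))%:num * normc (psi v) <= M) ->
  exists2 S : {linear wLinf mu -> wLinf mu},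
    (forall f, S f = wcomp psi phi f :> (T -> R[i])) & bounded_operator S.
Proof.
move=> M0 psiM.
have Sb f : wcomp psi phi f \in wbounded mu.
  by apply: (mem_wbounded _ (M * wnorm mu f)) => v; exact: wcomp_le.
pose S f := WLinf (Sb f).
have Slin : linear S.
  by move=> a f g; apply: wLinf_ext => v; rewrite /= /wcomp mulrDr mulrCA.
pose L : {linear wLinf mu -> wLinf mu} :=
  HB.pack S (GRing.isLinear.Build _ _ _ _ S Slin).
exists L => //.
exists M => f; rewrite !wLinf_normE -rmorphM lecR.
apply: wnorm_le => [|v]; last exact: wcomp_le.
by rewrite mulr_ge0 ?wnorm_ge0.
Qed.

(** A point of [T] is asked for because on an empty [T] the operator norm is [0], whereas the
    supremum over the empty range is [-oo]. *)
Lemma opnorm_wcomp psi phi (S : {linear wLinf mu -> wLinf mu}) :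
  (forall f, S f = wcomp psi phi f :> (T -> R[i])) -> T ->
  opnorm S = ereal_sup (range (fun v =>
    ((mu v)%:num / (mu (phi v))%:num * normc (psi v))%:E)).
Proof.
move=> SE o; apply/le_anti/andP; split; last first.
  apply: ge_ereal_sup => _ [v _ <-].
  (* [c] scales the indicator of [phi v] to norm one; the weighted value of [S g] at [v] is then
     exactly the term of index [v]. *)
  pose c : R := (mu (phi v))%:num^-1.
  pose g : wLinf mu := c%:C *: wdelta (phi v).
  have nc : normc c%:C = c.
    by rewrite /normc/= expr0n/= addr0 sqrtr_sqr gtr0_norm ?invr_gt0.
  have g1 : `|g| <= 1.
    by rewrite normrZ -[`|c%:C|]/((normc c%:C)%:C) wLinf_normE wnorm_wdelta
       -rmorphM nc /c mulVf.
  apply: (@le_trans _ _ (complex.Re `|S g|)%:E); last first.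
    by apply: ereal_sup_ubound; exists g.
  rewrite lee_fin wLinf_normE /=; apply: le_trans (le_wnorm (S g) v).
  by rewrite SE /wcomp wLinf_scaleE/= eqxx mulr1 normcM nc -mulrA [c * _]mulrC.
apply: ge_ereal_sup => _ [f f1 <-]; rewrite wLinf_normE /=.
move: f1; rewrite /= wLinf_normE lecR => f1.
set s := ereal_sup _.
have sub v : (((mu v)%:num / (mu (phi v))%:num * normc (psi v))%:E <= s)%E.
  by apply: ereal_sup_ubound; exists v.
(* The term at [o] rules out [-oo], and [+oo] bounds everything, so a real supremum [r] remains. *)
case: s sub => [r| |] sub; [|by rewrite leey|by have := sub o].
have {}sub v : (mu v)%:num / (mu (phi v))%:num * normc (psi v) <= r.
  by rewrite -lee_fin.
have r0 : 0 <= r.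
  by apply: le_trans (sub o); rewrite mulr_ge0 ?normc_ge0.
rewrite lee_fin; apply: wnorm_le => // v; rewrite SE.
by apply: le_trans (wcomp_le _ _ r f v (sub v)) _; rewrite ler_piMr.
Qed.

Section invertible.
Context {psi : T -> R[i]} {phi : T -> T} {W S : {linear wLinf mu -> wLinf mu}}.
Hypothesis WE : forall f, W f = wcomp psi phi f :> (T -> R[i]).
Hypotheses (WK : cancel W S) (SK : cancel S W).

Lemma wcomp_invE f v : psi v * S f (phi v) = f v.
Proof. by rewrite -[in RHS](SK f) WE. Qed.

Lemma wcomp_inv_neq0 v : psi v != 0.
Proof.
apply/eqP => psi0; have := wcomp_invE (wdelta v) v.
by rewrite psi0 mul0r /= eqxx; apply/eqP; rewrite eq_sym oner_neq0.
Qed.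

(** If [v] and [w] had the same image, the relation for [wdelta v] at [w] would make [S (wdelta v)]
    vanish there, while at [v] it makes [psi v] times that value equal to 1. *)
Lemma wcomp_inv_inj : injective phi.
Proof.
move=> v w vw; apply/eqP/negPn/negP => nvw.
have := wcomp_invE (wdelta v) w; rewrite -vw /= eq_sym (negbTE nvw).
move/eqP; rewrite mulf_eq0 (negbTE (wcomp_inv_neq0 w))/= => /eqP Sv0.
have := wcomp_invE (wdelta v) v; rewrite Sv0 mulr0 /= eqxx.
by apply/eqP; rewrite eq_sym oner_neq0.
Qed.

(** Over an empty fibre [W (wdelta w)] is zero, and [S] would send it back to the nonzero
    [wdelta w]. *)
Lemma wcomp_inv_surj w : exists v, phi v = w.
Proof.
apply: contrapT => nw; apply: (wdelta_neq0 w).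
rewrite -[LHS]WK (_ : W _ = 0) ?linear0//; apply: wLinf_ext => v.
rewrite WE /wcomp /=; case: eqP => [vw|_]; last by rewrite mulr0.
by case: nw; exists v.
Qed.

(** [S (wdelta v)] has value [1 / psi v] at [phi v], so its norm is at least [mu (phi v) / |psi v|],
    while [wdelta v] has norm [mu v]. *)
Lemma wcomp_inv_lower (M : R) : (forall f, `|S f| <= M%:C * `|f|) ->
  forall v, (mu (phi v))%:num <= M * ((mu v)%:num * normc (psi v)).
Proof.
move=> SM v; have psi0 := wcomp_inv_neq0 v.
have npsi0 : 0 < normc (psi v).
  rewrite lt_def normc_ge0 andbT; apply: contra psi0 => /eqP.
  by move/eq0_normc => ->.
have := SM (wdelta v).
rewrite !wLinf_normE -rmorphM lecR wnorm_wdelta => {}SM.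
rewrite mulrA -ler_pdivrMr//; apply: le_trans SM.
apply: le_trans (le_wnorm (S (wdelta v)) (phi v)).
rewrite ler_wpM2l// -normcV -[X in X <= _]mul1r.
have <- : normc (psi v * S (wdelta v) (phi v)) = 1.
  by rewrite wcomp_invE /= eqxx normc1.
by rewrite normcM normcV mulrAC mulfV ?mul1r// gt_eqF.
Qed.

End invertible.
End wLinf_operators.

Theorem theorem6p1 (R : realType) (T : metricType R) (o : T)
  (locally_finite : forall M : R, 0 < M ->
     finite_set [set v : T | mdist o v < M])
  (unbounded : forall M : R, 0 < M -> exists v : T, M <= mdist o v)
  (mu : T -> {posnum R}) (psi : T -> R[i]) (phi : T -> T)
  (W : {linear wLinf mu -> wLinf mu})
  (W_def : forall f : wLinf mu, W f = wcomp psi phi f :> (T -> R[i]))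
  (W_bounded : bounded_operator W) :
  ((exists S : {linear wLinf mu -> wLinf mu}, bounded_inverse W S) <->
     bijective phi /\
     (0 < ereal_inf (range (fun v : T =>
        ((mu v)%:num / (mu (phi v))%:num * normc (psi v))%:E)))%E)
  /\
  (forall (S : {linear wLinf mu -> wLinf mu}) (phiV : T -> T),
     bounded_inverse W S -> cancel phi phiV -> cancel phiV phi ->
     [/\ forall f : wLinf mu,
           S f = wcomp (fun v : T => 1 / psi (phiV v)) phiV f :> (T -> R[i]),
         opnorm S = ereal_sup (range (fun v : T =>
           ((mu v)%:num / (mu (phiV v))%:num
              * normc (1 / psi (phiV v)))%:E))
       & opnorm S = ereal_sup (range (fun v : T =>
           ((mu (phi v))%:num / (mu v)%:num * normc (1 / psi v))%:E))]).
Proof.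
split; last first.
  move=> S phiV [_ WK SK] phiK phiVK.
  have psi0 v : psi v != 0 by exact: (wcomp_inv_neq0 W_def SK).
  have SE (f : wLinf mu) :
      S f = wcomp (fun v : T => 1 / psi (phiV v)) phiV f :> (T -> R[i]).
    apply/funext => w; rewrite /wcomp -{2}(phiVK w).
    rewrite -(wcomp_invE W_def SK f (phiV w)) !phiVK.
    by rewrite mulrA divfK// mul1r.
  have normS := opnorm_wcomp _ _ _ SE o.
  (* The first formula is [normS]; reindexing along the bijection [phi] turns its range into that of
     the second. *)
  split=> //; rewrite normS; congr ereal_sup; apply/seteqP.
  by split=> _ [v _ <-]; [exists (phiV v)|exists (phi v)];
    rewrite ?phiVK ?phiK.
split=> [[S [[M SM] WK SK]]|[phi_bij inf_gt0]].
  split.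
    have phi_inj := wcomp_inv_inj W_def SK.
    have [phiV phiVK] := choice (wcomp_inv_surj W_def WK).
    by exists phiV => // v; apply: phi_inj; rewrite phiVK.
  have low := wcomp_inv_lower W_def SK M SM.
  (* A bound [M <= 0] would contradict [low] at the root, where [mu (phi o)] is positive. *)
  have M0 : 0 < M.
    rewrite ltNge; apply/negP => M0; have := low o.
    rewrite leNgt => /negP; apply; apply: le_lt_trans (gt0 (mu (phi o))).
    by rewrite mulr_le0_ge0// mulr_ge0// normc_ge0.
  apply: (@lt_le_trans _ _ (M^-1)%:E); first by rewrite lte_fin invr_gt0.
  apply: le_ereal_inf_tmp => _ [v _ <-]; rewrite lee_fin.
  by rewrite mulrAC ler_pdivlMr// ler_pdivrMl.
have [phiV phiK phiVK] := phi_bij.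
(* The extended infimum is a real number: it is positive, and at most the finite term at [o]. *)
have [c c0 cle] : exists2 c : R, 0 < c &
    forall v, c <= (mu v)%:num / (mu (phi v))%:num * normc (psi v).
  move: inf_gt0; set i := ereal_inf _ => i0.
  have ile v : (i <= ((mu v)%:num / (mu (phi v))%:num * normc (psi v))%:E)%E.
    by apply: ereal_inf_lbound; exists v.
  by case: i i0 ile => [r| |] // r0 ile; [exists r|have := ile o].
have psi0 v : psi v != 0.
  apply/eqP => psi0; have := lt_le_trans c0 (cle v).
  by rewrite psi0 normc0 mulr0 ltxx.
(* The ratio of the inverse symbols at [v] is the reciprocal of the original ratio at [phiV v],
   hence the bound [c^-1]. *)
have [|v|S SE Sb] := @bounded_wcomp R T mu (fun v => 1 / psi (phiV v)) phiV c^-1.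
- by rewrite invr_ge0 ltW.
- rewrite div1r normcV -[leLHS]invrK lef_pV2 ?posrE//.
    by have := cle (phiV v); rewrite phiVK invfM invrK invf_div.
  have := lt_le_trans c0 (cle (phiV v)).
  by rewrite phiVK invfM invrK invf_div.
exists S; split=> // f; apply: wLinf_ext => v.
  by rewrite SE /wcomp W_def /wcomp phiVK mulrA divfK// mul1r.
by rewrite W_def /wcomp SE /wcomp phiK mulrA mul1r mulfV// mul1r.
Qed.
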